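(* Let $k$ be an algebraically closed field of arbitrary characteristic, let $H$ be a finite-dimensional unimodular Hopf algebra over $k$, and let $J$ be a twist for $H$. Let $\lambda\in H^*$ and $\rho\in H^*$ be, respectively, non-zero left and right integrals on $H$. Put $Q_J=S(J^{(1)})J^{(2)}$ and $u_J=Q_J^{-1}S(Q_J)$. Then the elements $\lambda_J:=u_J\rightharpoonup\lambda$ and $\rho_J:=\rho\leftharpoonup u_J^{-1}$ of $H^*$ are, respectively, non-zero left and right integrals on the twisted Hopf algebra $H^J$.
   Context: Let $\Delta,\varepsilon,S$ be the comultiplication, counit and antipode of $H$; Sweedler notation $\Delta(h)=h_{(1)}\otimes h_{(2)}$. A twist for $H$ is an invertible $J\in H\otimes H$ with $(\Delta\otimes\mathrm{id})(J)(J\otimes 1)=(\mathrm{id}\otimes\Delta)(J)(1\otimes J)$, normalized by $(\varepsilon\otimes\mathrm{id})(J)=(\mathrm{id}\otimes\varepsilon)(J)=1$. Write $J=J^{(1)}\otimes J^{(2)}$ (summation understood). The element $Q_J$ is invertible. The twisted Hopf algebra $H^J$ has the same algebra structure and counit as $H$, comultiplication $\Delta^J(h)=J^{-1}\Delta(h)J$ and antipode $S^J(h)=Q_J^{-1}S(h)Q_J$. A left integral on a Hopf algebra $H$ is $\lambda\in H^*$ with $h_{(1)}\langle\lambda,h_{(2)}\rangle=\langle\lambda,h\rangle 1$ for all $h\in H$; a right integral on $H$ is $\rho\in H^*$ with $\langle\rho,h_{(1)}\rangle h_{(2)}=\langle\rho,h\rangle 1$ for all $h\in H$ (for $H^J$,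 use $\Delta^J$ instead of $\Delta$). $H$ is unimodular if the left and right integrals in $H$ coincide. The actions of $H$ on $H^*$ are $\langle h\rightharpoonup\phi,g\rangle=\langle\phi,gh\rangle$ and $\langle\phi\leftharpoonup h,g\rangle=\langle\phi,hg\rangle$ for $g,h\in H$, $\phi\in H^*$. *)

(* Defs.v *)
From HB Require Import structures.
From mathcomp Require Import all_boot all_algebra all_field.

Set Implicit Arguments.
Unset Strict Implicit.
Unset Printing Implicit Defensive.

Import GRing.Theory VectorInternalTheory.
Local Open Scope ring_scope.

(* The tensor product of two finite-dimensional spaces is realised by coordinate
   matrices, [tprod v w] being the pure tensor; [tliftE] and [tens_ext] are the
   existence and uniqueness parts of its universal property. *)

Section Tensor.
Variable k : fieldType.

Definition tens (V W : vectType k) : Type := 'M[k]_(dim V, dim W).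
HB.instance Definition _ (V W : vectType k) :=
  Vector.copy (tens V W) 'M[k]_(dim V, dim W).

Definition tprod (V W : vectType k) (v : V) (w : W) : tens V W :=
  (v2r v)^T *m v2r w.

(* The linear map on V (x) W induced by f, when f is bilinear. *)
Definition tlift (V W U : vectType k) (f : V -> W -> U) (t : tens V W) : U :=
  \sum_i \sum_j t i j *: f (r2v (delta_mx 0 i)) (r2v (delta_mx 0 j)).

End Tensor.

Reserved Notation "v ⊗ w" (at level 45, left associativity).
Reserved Notation "\tsum_ ( a ⊗ b <- t ) E"
  (at level 45, E at level 45, a name, b name, t at level 60,
   format "\tsum_ ( a  ⊗  b  <-  t )  E").

Notation "v ⊗ w" := (tprod v w) : ring_scope.
(* If t = \sum_i a_i ⊗ b_i and E is bilinear in (a, b), this is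
   \sum_i E[a_i, b_i]: Sweedler's summation convention. *)
Notation "\tsum_ ( a ⊗ b <- t ) E" := (tlift (fun a b => E) t) : ring_scope.

Section TensorTheory.
Variable k : fieldType.
Implicit Types U V W : vectType k.

Lemma tprodPr V W (v : V) : linear (@tprod k V W v).
Proof. by move=> a x y; rewrite /tprod linearP /= linearP. Qed.

Lemma tprodPl V W (w : W) : linear ((@tprod k V W)^~ w).
Proof.
move=> a x y; rewrite /tprod linearP /= linearP /=.
by rewrite mulmxDl -scalemxAl.
Qed.

HB.instance Definition _ V W (v : V) :=
  GRing.isLinear.Build k W (tens V W) _ (@tprod k V W v) (@tprodPr V W v).

Lemma tlift_linear V W U (f : V -> W -> U) : linear (tlift f).
Proof.
move=> a x y; rewrite /tlift scaler_sumr -big_split; apply: eq_bigr => i _ /=.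
rewrite scaler_sumr -big_split; apply: eq_bigr => j _ /=.
by rewrite !mxE scalerDl scalerA.
Qed.

HB.instance Definition _ V W U (f : V -> W -> U) :=
  GRing.isLinear.Build k (tens V W) U _ (tlift f) (tlift_linear f).

Lemma tliftE V W U (f : V -> W -> U) v w :
  bilinear_for *:%R *:%R f -> tlift f (v ⊗ w) = f v w.
Proof.
case=> fl fr.
pose g w := HB.pack_for {linear V -> U} (f^~ w)
  (GRing.isLinear.Build k V U _ (f^~ w) (fl w)).
pose h v := HB.pack_for {linear W -> U} (f v)
  (GRing.isLinear.Build k W U _ (f v) (fr v)).
have eV : v = \sum_i v2r v 0 i *: r2v (delta_mx 0 i).
  by rewrite -[LHS]v2rK {1}[v2r v]row_sum_delta linear_sum;
    apply: eq_bigr => i _; rewrite linearZ.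
have eW : w = \sum_i v2r w 0 i *: r2v (delta_mx 0 i).
  by rewrite -[LHS]v2rK {1}[v2r w]row_sum_delta linear_sum;
    apply: eq_bigr => i _; rewrite linearZ.
rewrite [in RHS]eV -[RHS]/(g w _) linear_sum /tlift; apply: eq_bigr => i _.
rewrite linearZ /= [in RHS]eW -[f _ _ in RHS]/(h _ _) linear_sum scaler_sumr.
apply: eq_bigr => j _; rewrite linearZ /= scalerA; congr (_ *: _).
by rewrite mxE big_ord1 mxE.
Qed.

Lemma tens_ind V W (P : tens V W -> Prop) :
  (forall x y, P x -> P y -> P (x + y)) -> (forall v w, P (v ⊗ w)) ->
  forall t, P t.
Proof.
move=> PD Pp t; have P0 : P 0 by have := Pp 0 0; rewrite linear0.
rewrite [t]matrix_sum_delta; elim/big_ind: _ => // i _.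
elim/big_ind: _ => // j _.
have -> : t i j *: delta_mx i j = r2v (delta_mx 0 i) ⊗ (t i j *: r2v (delta_mx 0 j)).
  rewrite linearZ /=; congr (_ *: _).
  by rewrite /tprod !r2vK trmx_delta mul_delta_mx.
exact: Pp.
Qed.

Lemma tens_ext V W U (f g : {linear tens V W -> U}) :
  (forall v w, f (v ⊗ w) = g (v ⊗ w)) -> f =1 g.
Proof. by move=> fg; elim/tens_ind => // x y fx fy; rewrite !linearD fx fy. Qed.

Lemma tprodDl V W (v v' : V) (w : W) : (v + v') ⊗ w = v ⊗ w + v' ⊗ w.
Proof. by have := tprodPl w 1 v v'; rewrite /= !scale1r. Qed.

Lemma eq_tlift V W U (f g : V -> W -> U) t : f =2 g -> tlift f t = tlift g t.
Proof. by move=> fg; do 2![apply: eq_bigr => ? _]; rewrite fg. Qed.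

Lemma tliftP V W U c (f g : V -> W -> U) t :
  \tsum_(a ⊗ b <- t) (c *: f a b + g a b) = c *: tlift f t + tlift g t.
Proof.
rewrite /tlift scaler_sumr -big_split; apply: eq_bigr => i _ /=.
rewrite scaler_sumr -big_split; apply: eq_bigr => j _ /=.
by rewrite scalerDr !scalerA mulrC.
Qed.

Lemma linear_tlift V W U U' (L : {linear U -> U'}) (f : V -> W -> U) t :
  L (tlift f t) = \tsum_(a ⊗ b <- t) L (f a b).
Proof.
rewrite /tlift linear_sum; apply: eq_bigr => i _.
by rewrite linear_sum; apply: eq_bigr => j _; rewrite linearZ.
Qed.

Lemma scaler_tlift V W U c (f : V -> W -> U) t :
  c *: tlift f t = \tsum_(a ⊗ b <- t) (c *: f a b).
Proof. exact: (linear_tlift ( *:%R c)). Qed.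

Lemma sum_tlift V W U (I : finType) (f : I -> V -> W -> U) t :
  \sum_i tlift (f i) t = \tsum_(a ⊗ b <- t) (\sum_i f i a b).
Proof.
rewrite /tlift exchange_big; apply: eq_bigr => i _ /=.
rewrite exchange_big; apply: eq_bigr => j _ /=.
by rewrite scaler_sumr.
Qed.

Lemma exchange_tlift V W V' W' U (f : V -> W -> V' -> W' -> U) s t :
  \tsum_(a ⊗ b <- s) (\tsum_(c ⊗ d <- t) f a b c d) =
  \tsum_(c ⊗ d <- t) (\tsum_(a ⊗ b <- s) f a b c d).
Proof.
rewrite [LHS]/tlift.
under eq_bigr => i _ do (under eq_bigr => j _ do rewrite scaler_tlift; rewrite sum_tlift).
by rewrite sum_tlift.
Qed.

Definition tmap V V' W W' (f : V -> V') (g : W -> W') (t : tens V W) :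
  tens V' W' := \tsum_(a ⊗ b <- t) (f a ⊗ g b).

Definition tassoc U V W (t : tens (tens U V) W) : tens U (tens V W) :=
  \tsum_(x ⊗ c <- t) (\tsum_(a ⊗ b <- x) (a ⊗ (b ⊗ c))).

HB.instance Definition _ V V' W W' (f : V -> V') (g : W -> W') :=
  GRing.isLinear.Build k (tens V W) (tens V' W') _ (tmap f g) (tlift_linear _).
HB.instance Definition _ U V W :=
  GRing.isLinear.Build k (tens (tens U V) W) (tens U (tens V W)) _
    (@tassoc U V W) (tlift_linear _).

Lemma tmapE V V' W W' (f : {linear V -> V'}) (g : {linear W -> W'}) v w :
  tmap f g (v ⊗ w) = f v ⊗ g w.
Proof. by rewrite /tmap tliftE //; split=> ? ? ? ? /=; rewrite linearP ?tprodPl ?linearP. Qed.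

Lemma tassocE U V W (u : U) (v : V) (w : W) :
  tassoc (u ⊗ v ⊗ w) = u ⊗ (v ⊗ w).
Proof.
rewrite /tassoc tliftE; last first.
  split=> [c|x] a y z /=; first by rewrite linearP.
  by rewrite -tliftP; apply: eq_tlift => ? ?; rewrite !linearP.
rewrite tliftE //; split=> ? ? ? ?; rewrite tprodPl ?linearP //.
Qed.

Lemma tlift_tmap V V' W W' U (f : {linear V -> V'}) (g : {linear W -> W'})
    (F : V' -> W' -> U) t : bilinear_for *:%R *:%R F ->
  tlift F (tmap f g t) = \tsum_(a ⊗ b <- t) F (f a) (g b).
Proof.
move=> Fb; rewrite /tmap (linear_tlift (tlift F)); apply: eq_tlift => a b /=.
by rewrite tliftE.
Qed.

Definition trilin U V W (Z : vectType k) (F : U -> V -> W -> Z) :=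
  [/\ forall v w, linear (fun u => F u v w), forall u w, linear (fun v => F u v w)
    & forall u v, linear (F u v)].

Lemma tlift_assoc U V W (Z : vectType k) (F : U -> V -> W -> Z) t : trilin F ->
  \tsum_(a ⊗ y <- tassoc t) (\tsum_(b ⊗ c <- y) F a b c) =
  \tsum_(x ⊗ c <- t) (\tsum_(a ⊗ b <- x) F a b c).
Proof.
move=> [F1 F2 F3]; rewrite /tassoc (linear_tlift (tlift _)); apply: eq_tlift => x c /=.
rewrite (linear_tlift (tlift _)); apply: eq_tlift => a b /=.
rewrite tliftE.
  by rewrite tliftE //; split.
split=> [y|u] d v w /=; last by rewrite linearP.
by rewrite -tliftP; apply: eq_tlift => ? ?; rewrite F1.
Qed.

End TensorTheory.

Section TensorAlgebra.
Variable k : fieldType.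
Implicit Types A B : falgType k.

Definition tmul A B (x y : tens A B) : tens A B :=
  \tsum_(a ⊗ b <- x) (\tsum_(c ⊗ d <- y) ((a * c) ⊗ (b * d))).

Lemma tmulPl A B (y : tens A B) : linear (@tmul A B ^~ y).
Proof. by move=> c x x'; rewrite /tmul linearP. Qed.

Lemma tmulPr A B (x : tens A B) : linear (@tmul A B x).
Proof.
by move=> c y y'; rewrite /tmul -tliftP; apply: eq_tlift => a b; rewrite linearP.
Qed.

Lemma tmulDl A B : left_distributive (@tmul A B) +%R.
Proof. by move=> x y z; rewrite -[x]scale1r tmulPl !scale1r. Qed.

Lemma tmulDr A B : right_distributive (@tmul A B) +%R.
Proof. by move=> x y z; rewrite -[y]scale1r tmulPr !scale1r. Qed.

Lemma tmulE A B (a c : A) (b d : B) : tmul (a ⊗ b) (c ⊗ d) = (a * c) ⊗ (b * d).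
Proof.
rewrite /tmul tliftE; last first.
  split=> [b'|a'] z x y /=; rewrite -tliftP; apply: eq_tlift=> u v.
    by rewrite mulrDl -scalerAl tprodPl.
  by rewrite mulrDl -scalerAl linearP.
rewrite tliftE //; split=> u z x y /=; rewrite mulrDr -scalerAr ?tprodPl ?linearP //.
Qed.

Lemma tmulA A B : associative (@tmul A B).
Proof.
move=> x y z; elim/tens_ind: x => [x x'|a b]; first by rewrite !tmulDl => -> ->.
elim/tens_ind: y => [y y'|c d]; first by rewrite !(tmulDl, tmulDr) => -> ->.
elim/tens_ind: z => [z z'|e f]; first by rewrite !tmulDr => -> ->.
by rewrite !tmulE !mulrA.
Qed.

Lemma tmul1 A B : left_id ((1 : A) ⊗ (1 : B)) (@tmul A B).
Proof. by elim/tens_ind=> [x y|a b]; rewrite ?tmulDr ?tmulE ?mul1r // => -> ->. Qed.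

Lemma tmulr1 A B : right_id ((1 : A) ⊗ (1 : B)) (@tmul A B).
Proof. by elim/tens_ind=> [x y|a b]; rewrite ?tmulDl ?tmulE ?mulr1 // => -> ->. Qed.

Lemma tprod_neq0 (V W : vectType k) (v : V) (w : W) :
  v != 0 -> w != 0 -> v ⊗ w != 0.
Proof.
rewrite -(inj_eq (@v2r_inj _ V)) linear0 -(inj_eq (@v2r_inj _ W)) linear0.
case/rV0Pn=> i vi /rV0Pn[j wj]; apply/eqP=> /matrixP/(_ i j)/eqP.
by rewrite !mxE big_ord1 mxE mulf_eq0 (negPf vi) (negPf wj).
Qed.

Lemma t1_neq0 A B : (1 : A) ⊗ (1 : B) != 0.
Proof. by rewrite tprod_neq0 ?oner_neq0. Qed.

HB.instance Definition _ A B := GRing.Zmodule_isNzRing.Build (tens A B)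
  (@tmulA A B) (@tmul1 A B) (@tmulr1 A B) (@tmulDl A B) (@tmulDr A B)
  (@t1_neq0 A B).

Lemma tscaleAl A B c (x y : tens A B) : c *: (x * y) = (c *: x) * y.
Proof. by have := tmulPl y c x 0; rewrite !addr0 /tmul linear0 addr0. Qed.

Lemma tscaleAr A B c (x y : tens A B) : c *: (x * y) = x * (c *: y).
Proof.
have e0 : tmul x 0 = 0 := mulr0 x.
by have := tmulPr x c y 0; rewrite e0 !addr0 => /esym.
Qed.

HB.instance Definition _ A B :=
  GRing.LSemiModule_isLSemiAlgebra.Build k (tens A B) (@tscaleAl A B).
HB.instance Definition _ A B :=
  GRing.LSemiAlgebra_isSemiAlgebra.Build k (tens A B) (@tscaleAr A B).
HB.instance Definition _ A B := Algebra_isFalgebra.Build k (tens A B).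

Lemma tprodM A B (a c : A) (b d : B) : (a ⊗ b) * (c ⊗ d) = (a * c) ⊗ (b * d).
Proof. exact: tmulE. Qed.

Lemma tprod11 A B : (1 : A) ⊗ (1 : B) = 1.
Proof. by []. Qed.

Lemma tlift_mul A B (U : vectType k) (F : A -> B -> U) x y :
  bilinear_for *:%R *:%R F ->
  tlift F (x * y) = \tsum_(a ⊗ b <- x) (\tsum_(c ⊗ d <- y) F (a * c) (b * d)).
Proof.
move=> Fb; rewrite [x * y]/(tmul x y) /tmul (linear_tlift (tlift _)).
apply: eq_tlift => a b; rewrite (linear_tlift (tlift _)).
by apply: eq_tlift => c d /=; rewrite tliftE.
Qed.

Lemma mulr_tlift A (V W : vectType k) (f : V -> W -> A) x t :
  x * tlift f t = \tsum_(a ⊗ b <- t) x * f a b.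
Proof.
rewrite /tlift mulr_sumr; apply: eq_bigr => i _.
by rewrite mulr_sumr; apply: eq_bigr => j _; rewrite scalerAr.
Qed.

Lemma mull_tlift A (V W : vectType k) (f : V -> W -> A) x t :
  tlift f t * x = \tsum_(a ⊗ b <- t) f a b * x.
Proof.
rewrite /tlift mulr_suml; apply: eq_bigr => i _.
by rewrite mulr_suml; apply: eq_bigr => j _; rewrite scalerAl.
Qed.

End TensorAlgebra.

Ltac lin_tac :=
  intros; cbv beta; rewrite /=;
  repeat (rewrite -tliftP; apply: eq_tlift => ? ? /=);
  rewrite ?(linearP, tprodPl, mulrDl, mulrDr) /=;
  rewrite ?(linearP, tprodPl, mulrDl, mulrDr, =^~ scalerAl, =^~ scalerAr) /=;
  rewrite ?(linearP, tprodPl, mulrDl, mulrDr, =^~ scalerAl, =^~ scalerAr) //.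
Ltac blin_tac := split; intros; intros ? ? ?; lin_tac.

Section Hopf.
Variable k : fieldType.
Implicit Type H : falgType k.

Record hopfAlgebra H := HopfAlgebra {
  comul : H -> tens H H;
  counit : H -> k^o;
  antipode : H -> H;
  comul_linear : linear comul;
  comul_monoid_morphism : monoid_morphism comul;
  counit_linear : linear counit;
  counit_monoid_morphism : monoid_morphism counit;
  antipode_linear : linear antipode;
  comul_coassoc h :
    tassoc (tmap comul idfun (comul h)) = tmap idfun comul (comul h);
  counitl h : \tsum_(a ⊗ b <- comul h) counit a *: b = h;
  counitr h : \tsum_(a ⊗ b <- comul h) counit b *: a = h;
  antipodel h : \tsum_(a ⊗ b <- comul h) antipode a * b = counit h *: 1;
  antipoder h : \tsum_(a ⊗ b <- comul h) a * antipode b = counit h *: 1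
}.

HB.instance Definition _ H (X : hopfAlgebra H) :=
  GRing.isLinear.Build k H (tens H H) _ (comul X) (comul_linear X).
HB.instance Definition _ H (X : hopfAlgebra H) :=
  GRing.isMonoidMorphism.Build H (tens H H) (comul X) (comul_monoid_morphism X).
HB.instance Definition _ H (X : hopfAlgebra H) :=
  GRing.isLinear.Build k H k^o _ (counit X) (counit_linear X).
HB.instance Definition _ H (X : hopfAlgebra H) :=
  GRing.isMonoidMorphism.Build H k^o (counit X) (counit_monoid_morphism X).
HB.instance Definition _ H (X : hopfAlgebra H) :=
  GRing.isLinear.Build k H H _ (antipode X) (antipode_linear X).

Section HopfTheory.
Variables (H : falgType k) (X : hopfAlgebra H).
Notation Δ := (comul X).
Notation ε := (counit X).
Notation S := (antipode X).

Lemma counitP c x y : ε (c *: x + y) = c * ε x + ε y.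
Proof. exact: linearP. Qed.

Lemma comul_sweedler (Z : vectType k) (F : H -> H -> H -> Z) h : trilin F ->
  \tsum_(a ⊗ y <- Δ h) \tsum_(b ⊗ c <- Δ y) F a b c =
  \tsum_(x ⊗ c <- Δ h) \tsum_(a ⊗ b <- Δ x) F a b c.
Proof.
move=> Ft; have [F1 F2 F3] := Ft.
have /(congr1 (tlift (fun a y => tlift (F a) y))) := comul_coassoc X h.
rewrite tlift_assoc // !tlift_tmap //.
  by split=> [y|u] d v w /=; [rewrite -tliftP; apply: eq_tlift => ? ?; rewrite F1 | rewrite linearP].
by split=> [y|u] d v w /=; [rewrite linearP | rewrite -tliftP; apply: eq_tlift => ? ?; rewrite F3].
Qed.

Lemma antipode1 : S 1 = 1.
Proof.
have := antipodel X 1; rewrite !rmorph1 scale1r -tprod11 tliftE ?mulr1 //.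
by blin_tac.
Qed.

Lemma antipodeM x y : S (x * y) = S y * S x.
Proof.
pose K := \tsum_(a ⊗ x' <- Δ x) \tsum_(b ⊗ c <- Δ x')
  \tsum_(a' ⊗ y' <- Δ y) \tsum_(b' ⊗ c' <- Δ y') (S (a * a') * (b * b') * (S c' * S c)).
have -> : S (x * y) = K.
  have e a x' : \tsum_(b ⊗ c <- Δ x') \tsum_(a' ⊗ y' <- Δ y)
      \tsum_(b' ⊗ c' <- Δ y') (S (a * a') * (b * b') * (S c' * S c)) =
      ε x' *: S (a * y).
    have e1 b c : \tsum_(a' ⊗ y' <- Δ y) \tsum_(b' ⊗ c' <- Δ y')
       (S (a * a') * (b * b') * (S c' * S c)) = S (a * y) * (b * S c).
      rewrite -{2}[y](counitr X) mulr_tlift linear_tlift mull_tlift.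
      apply: eq_tlift => a' y' /=.
      transitivity (S (a * a') * b * (\tsum_(b' ⊗ c' <- Δ y') b' * S c') * S c).
        by rewrite mulr_tlift mull_tlift; apply: eq_tlift => u v; rewrite !mulrA.
      by rewrite antipoder -scalerAr mulr1 -!scalerAl -scalerAr linearZ /= -scalerAl !mulrA.
    under eq_tlift do rewrite e1.
    by rewrite -mulr_tlift antipoder -scalerAr mulr1.
  rewrite /K; under eq_tlift do rewrite e.
  rewrite -{1}[x](counitr X) mull_tlift linear_tlift; apply: eq_tlift => a b /=.
  by rewrite -scalerAl linearZ.
rewrite /K comul_sweedler; last by split; intros; intros ? ? ?; lin_tac.
have e x' c : \tsum_(a ⊗ b <- Δ x') \tsum_(a' ⊗ y' <- Δ y) \tsum_(b' ⊗ c' <- Δ y')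
    (S (a * a') * (b * b') * (S c' * S c)) = ε x' *: (S y * S c).
  under eq_tlift => a b.
    rewrite comul_sweedler; last by split; intros; intros ? ? ?; lin_tac.
    over.
  rewrite /= exchange_tlift -{2}[y](counitl X) linear_tlift mull_tlift scaler_tlift.
  apply: eq_tlift => y' c' /=; rewrite linearZ -scalerAl scalerA -(rmorphM ε) /=.
  transitivity ((\tsum_(u ⊗ v <- Δ (x' * y')) S u * v) * (S c' * S c)).
    rewrite rmorphM tlift_mul; last by blin_tac.
    rewrite mull_tlift; apply: eq_tlift => a b /=.
    by rewrite mull_tlift; apply: eq_tlift => a' b' /=.
  by rewrite antipodel -scalerAl mul1r.
under eq_tlift do rewrite e.
rewrite -{2}[x](counitl X) linear_tlift mulr_tlift; apply: eq_tlift => a b /=.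
by rewrite linearZ -scalerAr.
Qed.

(* [tassoc] identifies the two bracketings of H (x) H (x) H. *)
Definition is_twist (J : tens H H) : Prop :=
  [/\ J \is a GRing.unit,
      tassoc (tmap Δ idfun J * (J ⊗ (1 : H))) = tmap idfun Δ J * ((1 : H) ⊗ J),
      \tsum_(a ⊗ b <- J) ε a *: b = 1
    & \tsum_(a ⊗ b <- J) ε b *: a = 1].

Definition twistQ (J : tens H H) : H := \tsum_(a ⊗ b <- J) S a * b.
Definition twistu (J : tens H H) : H := (twistQ J)^-1 * S (twistQ J).

Definition twisted_comul (J : tens H H) (h : H) : tens H H := J^-1 * Δ h * J.
Definition twisted_antipode (J : tens H H) (h : H) : H :=
  (twistQ J)^-1 * S h * twistQ J.

Definition antl z (t : tens H H) : H := \tsum_(a ⊗ b <- t) S a * z * b.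
Definition antr z (t : tens H H) : H := \tsum_(a ⊗ b <- t) a * z * S b.
Definition epsl (t : tens H H) : H := \tsum_(a ⊗ b <- t) ε a *: b.
Definition epsr (t : tens H H) : H := \tsum_(a ⊗ b <- t) ε b *: a.

Lemma antlE z a b : antl z (a ⊗ b) = S a * z * b.
Proof. by rewrite /antl tliftE //; blin_tac. Qed.
Lemma antrE z a b : antr z (a ⊗ b) = a * z * S b.
Proof. by rewrite /antr tliftE //; blin_tac. Qed.
Lemma epslE a b : epsl (a ⊗ b) = ε a *: b.
Proof.
rewrite /epsl tliftE //; split=> [w|v] c x y; last by rewrite /= linearP.
by rewrite /= counitP scalerDl scalerA.
Qed.
Lemma epsrE a b : epsr (a ⊗ b) = ε b *: a.
Proof.
rewrite /epsr tliftE //; split=> [w|v] c x y; first by rewrite /= linearP.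
by rewrite /= counitP scalerDl scalerA.
Qed.

Lemma antlD z s t : antl z (s + t) = antl z s + antl z t. Proof. exact: linearD. Qed.
Lemma antrD z s t : antr z (s + t) = antr z s + antr z t. Proof. exact: linearD. Qed.
Lemma epslD s t : epsl (s + t) = epsl s + epsl t. Proof. exact: linearD. Qed.
Lemma epsrD s t : epsr (s + t) = epsr s + epsr t. Proof. exact: linearD. Qed.

Lemma antlzD z z' t : antl (z + z') t = antl z t + antl z' t.
Proof.
elim/tens_ind: t => [s t|a b]; last by rewrite !antlE mulrDr mulrDl.
by rewrite !antlD => -> ->; rewrite addrACA.
Qed.
Lemma antrzD z z' t : antr (z + z') t = antr z t + antr z' t.
Proof.
elim/tens_ind: t => [s t|a b]; last by rewrite !antrE mulrDr mulrDl.
by rewrite !antrD => -> ->; rewrite addrACA.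
Qed.

Lemma antlM z s t : antl z (s * t) = antl (antl z s) t.
Proof.
elim/tens_ind: s => [s s'|a b]; first by rewrite mulrDl !antlD antlzD => -> ->.
elim/tens_ind: t => [t t'|c d]; first by rewrite mulrDr !antlD => -> ->.
by rewrite tprodM !antlE antipodeM !mulrA.
Qed.
Lemma antrM z s t : antr z (s * t) = antr (antr z t) s.
Proof.
elim/tens_ind: t => [t t'|c d]; first by rewrite mulrDr !antrD antrzD => -> ->.
elim/tens_ind: s => [s s'|a b]; first by rewrite mulrDl !antrD => -> ->.
by rewrite tprodM !antrE antipodeM !mulrA.
Qed.
Lemma epslM s t : epsl (s * t) = epsl s * epsl t.
Proof.
elim/tens_ind: s => [s s'|a b]; first by rewrite !(mulrDl, epslD) => -> ->.
elim/tens_ind: t => [t t'|c d]; first by rewrite !(mulrDr, epslD) => -> ->.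
by rewrite tprodM !epslE rmorphM /= -scalerAl -scalerAr scalerA.
Qed.
Lemma epsrM s t : epsr (s * t) = epsr s * epsr t.
Proof.
elim/tens_ind: s => [s s'|a b]; first by rewrite !(mulrDl, epsrD) => -> ->.
elim/tens_ind: t => [t t'|c d]; first by rewrite !(mulrDr, epsrD) => -> ->.
by rewrite tprodM !epsrE rmorphM /= -scalerAl -scalerAr scalerA.
Qed.
Lemma antl1 z : antl z 1 = z. Proof. by rewrite -tprod11 antlE antipode1 mul1r mulr1. Qed.
Lemma antr1 z : antr z 1 = z. Proof. by rewrite -tprod11 antrE antipode1 mul1r mulr1. Qed.
Lemma epsl1 : epsl 1 = 1. Proof. by rewrite -tprod11 epslE rmorph1 scale1r. Qed.
Lemma epsr1 : epsr 1 = 1. Proof. by rewrite -tprod11 epsrE rmorph1 scale1r. Qed.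

Lemma antl1E t : antl 1 t = \tsum_(a ⊗ b <- t) S a * b.
Proof. by apply: eq_tlift => a b; rewrite mulr1. Qed.
Lemma antr1E t : antr 1 t = \tsum_(a ⊗ b <- t) a * S b.
Proof. by apply: eq_tlift => a b; rewrite mulr1. Qed.
Lemma antlQ J : antl 1 J = twistQ J. Proof. exact: antl1E. Qed.

Lemma tassocM (A B C : falgType k) (x y : tens (tens A B) C) :
  tassoc (x * y) = tassoc x * tassoc y.
Proof.
elim/tens_ind: x => [x x'|u c]; first by rewrite !(mulrDl, linearD) /= => -> ->.
elim/tens_ind: y => [y y'|v d]; first by rewrite !(mulrDr, linearD) /= => -> ->.
elim/tens_ind: u => [x x'|a b].
  by rewrite tprodDl !(mulrDl, linearD) /= => -> ->.
elim/tens_ind: v => [x x'|e f].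
  by rewrite tprodDl !(mulrDr, linearD) /= => -> ->.
by rewrite !tprodM !tassocE !tprodM.
Qed.

Lemma tassoc1 (A B C : falgType k) : tassoc (1 : tens (tens A B) C) = 1.
Proof. by rewrite -!tprod11 tassocE. Qed.

Lemma tmapM (A B C D : falgType k) (f : {linear A -> B}) (g : {linear C -> D}) :
  {morph f : x y / x * y} -> {morph g : x y / x * y} ->
  {morph tmap f g : x y / x * y}.
Proof.
move=> fM gM x y.
elim/tens_ind: x => [x x'|a b]; first by rewrite !(mulrDl, linearD) /= => -> ->.
elim/tens_ind: y => [y y'|c d]; first by rewrite !(mulrDr, linearD) /= => -> ->.
by rewrite tprodM !tmapE tprodM fM gM.
Qed.

Definition comull (t : tens H H) := tmap Δ idfun t.
Definition comulr (t : tens H H) := tmap idfun Δ t.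
Lemma comullM : {morph comull : x y / x * y}.
Proof. by apply: tmapM => // x y; rewrite rmorphM. Qed.
Lemma comulrM : {morph comulr : x y / x * y}.
Proof. by apply: tmapM => // x y; rewrite rmorphM. Qed.
Lemma comull1 : comull 1 = 1. Proof. by rewrite /comull -tprod11 tmapE !rmorph1. Qed.
Lemma comulr1 : comulr 1 = 1. Proof. by rewrite /comulr -tprod11 tmapE !rmorph1. Qed.

Section Twist.
Variables (J : tens H H) (twJ : is_twist J).
Lemma twist_unit : J \is a GRing.unit. Proof. by case: twJ. Qed.
#[local] Hint Resolve twist_unit : core.

Definition fold_S2 (t : tens H (tens H H)) : H :=
  \tsum_(a ⊗ y <- t) \tsum_(b ⊗ c <- y) a * S b * c.
Lemma fold_S2D s t : fold_S2 (s + t) = fold_S2 s + fold_S2 t. Proof. exact: linearD. Qed.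
Lemma fold_S2E a b c : fold_S2 (a ⊗ (b ⊗ c)) = a * S b * c.
Proof.
rewrite /fold_S2 tliftE; last by blin_tac.
by rewrite tliftE //; blin_tac.
Qed.

Lemma fold_S2_JJV s t : fold_S2 (((1 : H) ⊗ s) * tassoc (t ⊗ (1 : H))) = antr 1 t * antl 1 s.
Proof.
elim/tens_ind: s => [x y|a b].
  by rewrite linearD mulrDl fold_S2D antlD mulrDr => -> ->.
elim/tens_ind: t => [x y|c d].
  by rewrite tprodDl linearD mulrDr fold_S2D antrD mulrDl => -> ->.
by rewrite tassocE !tprodM fold_S2E antlE antrE antipodeM !(mul1r, mulr1) !mulrA.
Qed.

Lemma fold_S2_comul s t : fold_S2 (comulr s * tassoc (comull t)) = epsr s * epsl t.
Proof.
elim/tens_ind: s => [x y|a b].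
  by rewrite /comulr linearD mulrDl fold_S2D epsrD mulrDl => -> ->.
elim/tens_ind: t => [x y|c d].
  by rewrite /comull !linearD /= mulrDr fold_S2D epslD mulrDr => -> ->.
rewrite /comull /comulr !tmapE /=.
have e B C : fold_S2 ((a ⊗ B) * tassoc (C ⊗ d)) = a * antr 1 C * antl 1 B * d.
  elim/tens_ind: B => [x y|u v].
    by rewrite linearD mulrDl fold_S2D antlD mulrDr mulrDl => -> ->.
  elim/tens_ind: C => [x y|u' v'].
    by rewrite tprodDl linearD mulrDr fold_S2D antrD mulrDr !mulrDl => -> ->.
  by rewrite tassocE !tprodM fold_S2E antlE antrE antipodeM !mulr1 !mulrA.
rewrite e antr1E antl1E antipoder antipodel epsrE epslE.
by rewrite -!(scalerAl, scalerAr) !mulr1 -?(scalerAl, scalerAr) !scalerA ?(mulrC (ε b)).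
Qed.

Lemma twist_PQ : antr 1 J^-1 * antl 1 J = 1.
Proof.
case: twJ => _ tw Jl Jr; rewrite -fold_S2_JJV.
have -> : ((1 : H) ⊗ J) * tassoc (J^-1 ⊗ (1 : H)) = comulr J^-1 * tassoc (comull J).
  have e : tassoc (J ⊗ (1 : H)) * tassoc (J^-1 ⊗ (1 : H)) = 1.
    by rewrite -tassocM tprodM divrr // mulr1 tprod11 tassoc1.
  have tw' : tassoc (comull J) * tassoc (J ⊗ (1 : H)) = comulr J * ((1 : H) ⊗ J).
    by rewrite -tassocM tw.
  rewrite -[tassoc (comull J)]mulr1 -e [tassoc (comull J) * _]mulrA tw' !mulrA -comulrM.
  by rewrite mulVr // comulr1 mul1r.
have elJ : epsl J = 1 by exact: Jl.
rewrite fold_S2_comul elJ mulr1.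
have erJ : epsr J = 1 by exact: Jr.
by have := epsrM J^-1 J; rewrite mulVr // epsr1 erJ mulr1 => <-.
Qed.

Lemma twistQ_sub : antr 1 J^-1 * twistQ J = 1 /\ twistQ J * antr 1 J^-1 = 1.
Proof.
have PQ : antr 1 J^-1 * twistQ J = 1 by rewrite -antlQ twist_PQ.
split=> //; set P := antr _ _ in PQ *; set Q := twistQ J in PQ *.
have kP : lker (amulr P) == 0%VS.
  by apply/lker0P=> x y /(congr1 ( *%R^~ Q)); rewrite !lfunE /= -!mulrA PQ !mulr1.
have := lker0_lfunVK kP 1; rewrite lfunE /=; set u := (_^-1)%VF _ => uP.
by rewrite -[Q]mul1r -uP -(mulrA u) PQ mulr1.
Qed.

Lemma twistQ_unit : twistQ J \is a GRing.unit.
Proof. by have [PQ QP] := twistQ_sub; apply/unitrP; exists (antr 1 J^-1). Qed.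

Lemma twistQ_inv : (twistQ J)^-1 = \tsum_(a ⊗ b <- J^-1) a * S b.
Proof.
have [PQ QP] := twistQ_sub; apply: (mulIr twistQ_unit).
by rewrite mulVr ?twistQ_unit // -antr1E PQ.
Qed.

Fact twisted_comul_linear : linear (twisted_comul J).
Proof.
by move=> c x y; rewrite /twisted_comul linearP mulrDr mulrDl -scalerAr -scalerAl.
Qed.

Fact twisted_comul_monoid_morphism : monoid_morphism (twisted_comul J).
Proof.
split=> [|x y]; first by rewrite /twisted_comul rmorph1 mulr1 mulVr.
by rewrite /twisted_comul rmorphM !mulrA (mulrK twist_unit).
Qed.

HB.instance Definition _ :=
  GRing.isLinear.Build k H (tens H H) _ (twisted_comul J) twisted_comul_linear.

Fact twisted_antipode_linear : linear (twisted_antipode J).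
Proof.
by move=> c x y; rewrite /twisted_antipode linearP mulrDr mulrDl -scalerAr -scalerAl.
Qed.

Fact twisted_coassoc h :
  tassoc (tmap (twisted_comul J) idfun (twisted_comul J h)) =
  tmap idfun (twisted_comul J) (twisted_comul J h).
Proof.
have e1 t : tmap (twisted_comul J) idfun t =
    (J^-1 ⊗ (1 : H)) * comull t * (J ⊗ (1 : H)).
  elim/tens_ind: t => [x y|a b].
    by rewrite /comull !linearD /= mulrDr mulrDl => -> ->.
  by rewrite /comull !tmapE /= !tprodM mul1r mulr1.
have e2 t : tmap idfun (twisted_comul J) t =
    ((1 : H) ⊗ J^-1) * comulr t * ((1 : H) ⊗ J).
  elim/tens_ind: t => [x y|a b].
    by rewrite /comulr !linearD /= mulrDr mulrDl => -> ->.
  by rewrite /comulr !tmapE /= !tprodM mul1r mulr1.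
rewrite e1 e2 /twisted_comul !comullM !comulrM.
case: twJ => _ tw _ _.
pose A := comull J * (J ⊗ (1 : H)); pose A' := (J^-1 ⊗ (1 : H)) * comull J^-1.
pose B := comulr J * ((1 : H) ⊗ J); pose B' := ((1 : H) ⊗ J^-1) * comulr J^-1.
have AA : A' * A = 1.
  by rewrite /A' /A -mulrA (mulrA (comull _)) -comullM mulVr // comull1 mul1r tprodM mulVr // mulr1.
have BB : B * B' = 1.
  rewrite /B' /B -mulrA (mulrA (_ ⊗ J)) tprodM divrr // mulr1 tprod11.
  by rewrite mul1r -comulrM divrr // comulr1.
have AB : tassoc A = B by [].
have AB' : tassoc A' = B'.
  by rewrite -[LHS]mulr1 -BB mulrA -AB -tassocM AA tassoc1 mul1r.
transitivity (tassoc (A' * comull (Δ h) * A)); first by congr tassoc; rewrite !mulrA.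
by rewrite (tassocM (A' * _) A) (tassocM A') AB AB' /comull comul_coassoc /B /B' !mulrA.
Qed.

Fact twisted_counitl h : \tsum_(a ⊗ b <- twisted_comul J h) ε a *: b = h.
Proof.
case: twJ => _ _ Jl _; rewrite -/(epsl _) /twisted_comul !epslM (_ : epsl J = 1) //.
rewrite [epsl (Δ h)]counitl mulr1.
have := epslM J^-1 J; rewrite mulVr // epsl1 (_ : epsl J = 1) // mulr1 => <-.
by rewrite mul1r.
Qed.

Fact twisted_counitr h : \tsum_(a ⊗ b <- twisted_comul J h) ε b *: a = h.
Proof.
case: twJ => _ _ _ Jr; rewrite -/(epsr _) /twisted_comul !epsrM (_ : epsr J = 1) //.
rewrite [epsr (Δ h)]counitr mulr1.
have := epsrM J^-1 J; rewrite mulVr // epsr1 (_ : epsr J = 1) // mulr1 => <-.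
by rewrite mul1r.
Qed.

Lemma antlZ c t : antl (c *: 1) t = c *: antl 1 t.
Proof.
by rewrite /antl scaler_tlift; apply: eq_tlift => a b; rewrite -scalerAr -scalerAl.
Qed.
Lemma antrZ c t : antr (c *: 1) t = c *: antr 1 t.
Proof.
by rewrite /antr scaler_tlift; apply: eq_tlift => a b; rewrite -scalerAr -scalerAl.
Qed.

Fact twisted_antipodel h :
  \tsum_(a ⊗ b <- twisted_comul J h) twisted_antipode J a * b = ε h *: 1.
Proof.
transitivity ((twistQ J)^-1 * antl (twistQ J) (twisted_comul J h)).
  by rewrite /antl mulr_tlift; apply: eq_tlift => a b; rewrite /twisted_antipode !mulrA.
have e : antl (twistQ J) J^-1 = 1 by rewrite -antlQ -antlM divrr // antl1.
rewrite /twisted_comul !antlM e antl1E antipodel.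
by rewrite antlZ antlQ -scalerAr mulVr // twistQ_unit.
Qed.

Fact twisted_antipoder h :
  \tsum_(a ⊗ b <- twisted_comul J h) a * twisted_antipode J b = ε h *: 1.
Proof.
transitivity (antr (twistQ J)^-1 (twisted_comul J h) * twistQ J).
  by rewrite /antr mull_tlift; apply: eq_tlift => a b; rewrite /twisted_antipode !mulrA.
have e : antr (twistQ J)^-1 J = 1 by rewrite twistQ_inv -antr1E -antrM divrr // antr1.
rewrite /twisted_comul !antrM e antr1E antipoder.
by rewrite antrZ antr1E -twistQ_inv -scalerAl mulVr // twistQ_unit.
Qed.

Definition twisted : hopfAlgebra H :=
  HopfAlgebra twisted_comul_linear twisted_comul_monoid_morphism
    (counit_linear X) (counit_monoid_morphism X) twisted_antipode_linear
    twisted_coassoc twisted_counitl twisted_counitr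
    twisted_antipodel twisted_antipoder.

End Twist.
End HopfTheory.

Section Integrals.
Variables (H : falgType k) (X : hopfAlgebra H).
Implicit Types (h g t : H) (phi : 'Hom(H, k^o)).

(* Integrals in H, as opposed to the integrals on H below, which lie in H^*. *)
Definition left_integral_in t : Prop := forall h, h * t = counit X h *: t.
Definition right_integral_in t : Prop := forall h, t * h = counit X h *: t.
Definition unimodular : Prop :=
  forall t, left_integral_in t <-> right_integral_in t.

Definition left_integral_on phi : Prop :=
  forall h, \tsum_(a ⊗ b <- comul X h) phi b *: a = phi h *: 1.
Definition right_integral_on phi : Prop :=
  forall h, \tsum_(a ⊗ b <- comul X h) phi a *: b = phi h *: 1.

End Integrals.

(* H^* is 'Hom(H, k^o); see [lactE] and [ractE] for the values. *)
Definition lact H (h : H) (phi : 'Hom(H, k^o)) : 'Hom(H, k^o) :=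
  (phi \o amulr h)%VF.
Definition ract H (phi : 'Hom(H, k^o)) (h : H) : 'Hom(H, k^o) :=
  (phi \o amull h)%VF.

Lemma lactE H (h : H) phi g : lact h phi g = phi (g * h).
Proof. by rewrite comp_lfunE lfunE. Qed.

Lemma ractE H phi (h : H) g : ract phi h g = phi (h * g).
Proof. by rewrite comp_lfunE lfunE. Qed.

End Hopf.

Notation "h ⇀ phi" := (lact h phi) (at level 44, right associativity) : ring_scope.
Notation "phi ↼ h" := (ract phi h) (at level 45, left associativity) : ring_scope.

(* Main.v *)
Require Import Defs.
From HB Require Import structures.
From mathcomp Require Import all_boot all_algebra all_field.

Set Implicit Arguments.
Unset Strict Implicit.
Unset Printing Implicit Defensive.

Import GRing.Theory.
Local Open Scope ring_scope.

(** Let t be the integral in H with lambda(h t) = eps(h) for all h; it exists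
    because g |-> lambda(_ g) is a bijection from H onto H^*, and unimodularity
    makes it two-sided.  Being an integral in H only involves the product and
    the counit, so t is also an integral in H^J, and the integrals on H^J should
    be the functionals phi normalized by t_1 phi(t_2) = c 1 (left) or
    phi(t_1) t_2 = c 1 (right), for the coproduct of H^J.
    [left_integral_test] and [right_integral_test] prove, by coassociativity,
    that such a phi is an integral as soon as slicing the coproduct of t by
    functionals is injective.  It then remains to slice J^-1 Delta(t) J.

    For the untwisted Delta(t), one identity,
    S(h_1) lambda(h_2 g) = lambda(h g_2) g_1 ([left_integral_antipode]), gives
    by taking either g = t or h = t
      t_1 lambda(g t_2) = S(g)   and   S(t_1) lambda(t_2 g) = g.
    The second one shows that S is bijective, and both together give the
    commutation rule lambda(x y) = lambda(y S^2(x)).  With that rule, the outer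
    factors J^-1 and J can be pulled out of the slices, and they recombine into
    Q = Q_J and its inverse: the left slice of the twisted coproduct of t by
    g -> lambda, followed by S, is
      S(J^(1)) J^(2) g S^2(K^(2)) S(K^(1)) = Q g S(Q)^-1,   K = J^-1.
    This is injective in g, and equals 1 = S(1) exactly for
    g = Q^-1 S(Q) = u_J.  For a right integral rho the same computation
    yields rho(t) S(Q) g Q^-1, which is rho(t) 1 for g = u_J^-1; here
    rho(t) is non-zero because rho(S(x)) = rho(t) lambda(x). *)

(** * Functionals on a finite-dimensional space *)

Section LinearAlgebra.
Variables (k : fieldType) (V : vectType k).

Lemma functional_ext (x y : V) :
  (forall psi : 'Hom(V, k^o), psi x = psi y) -> x = y.
Proof.
move=> e; rewrite (coord_vbasis (memvf x)) (coord_vbasis (memvf y)).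
apply: eq_bigr => i _.
by have := e (linfun (coord (vbasis {:V}) i : V -> k^o)); rewrite !lfunE /= => ->.
Qed.

Lemma functional_repr (B : V -> 'Hom(V, k^o)) : linear B ->
  injective B -> forall chi, exists v, chi = B v.
Proof.
move=> linB injB chi.
pose L : {linear V -> 'Hom(V, k^o)} := HB.pack_for {linear V -> 'Hom(V, k^o)} B
  (GRing.isLinear.Build k V 'Hom(V, k^o) _ B linB).
have LE v : linfun L v = B v by rewrite lfunE.
have kL : lker (linfun L) == 0%VS.
  by apply/lker0P=> u v; rewrite !LE => /injB.
have: limg (linfun L) == fullv.
  (* The dimension of 'Hom(V, k^o) is \dim V * 1. *)
  by rewrite eqEdim subvf limg_dim_eq ?(eqP kL) ?capv0 // !dimvf /dim /= muln1.
by move/eqP=> iL; have := memvf chi; rewrite -iL => /memv_imgP[v _ ->]; exists v; rewrite LE.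
Qed.

End LinearAlgebra.

(** * Slicing a tensor by a functional *)

Section Slices.
Variables (k : fieldType) (H : falgType k).
Implicit Types (phi chi psi : 'Hom(H, k^o)) (s t : tens H H) (a b g : H).

Definition slicer phi t : H := \tsum_(a ⊗ b <- t) phi b *: a.
Definition slicel phi t : H := \tsum_(a ⊗ b <- t) phi a *: b.

HB.instance Definition _ phi :=
  GRing.isLinear.Build k (tens H H) H _ (slicer phi) (tlift_linear _).
HB.instance Definition _ phi :=
  GRing.isLinear.Build k (tens H H) H _ (slicel phi) (tlift_linear _).

Lemma slicerE phi a b : slicer phi (a ⊗ b) = phi b *: a.
Proof.
rewrite /slicer tliftE //; split=> [w|v] c x y /=; rewrite ?linearP //=.
by rewrite scalerDl scalerA.
Qed.

Lemma slicelE phi a b : slicel phi (a ⊗ b) = phi a *: b.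
Proof.
rewrite /slicel tliftE //; split=> [w|v] c x y /=; rewrite ?linearP //=.
by rewrite scalerDl scalerA.
Qed.

(** Expanding the left factors in a basis reduces a property of all of t to a
    property of its slices; the second factors of Delta(g) are handled this way
    in [lact_inj]. *)
Lemma tens_slicel_basis t :
  t = \sum_(i < \dim {:H}) ((vbasis {:H})`_i ⊗
    slicel (linfun (coord (vbasis {:H}) i : H -> k^o)) t).
Proof.
elim/tens_ind: t => [x y|a b].
  move=> {1}-> {1}->; rewrite -big_split; apply: eq_bigr => i _ /=.
  by rewrite !linearD.
rewrite {1}(coord_vbasis (memvf a)).
pose L := HB.pack_for {linear H -> tens H H} (fun x => x ⊗ b)
  (GRing.isLinear.Build k H (tens H H) _ (fun x => x ⊗ b) (tprodPl b)).
rewrite -[LHS]/(L _) linear_sum; apply: eq_bigr => i _.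
by rewrite slicelE lfunE !linearZ.
Qed.

(** The factors on the leg that is not sliced come out of the slice, while those
    on the sliced leg are absorbed by the functional.  The functional phi' is a
    parameter since in the applications it is obtained from phi by moving b
    (resp. a) cyclically past x. *)
Lemma slicer_sandwich phi phi' a b c d t :
  (forall x, phi (b * x * d) = phi' x) ->
  slicer phi ((a ⊗ b) * t * (c ⊗ d)) = a * slicer phi' t * c.
Proof.
move=> e; elim/tens_ind: t => [x y|x y].
  by rewrite !(mulrDr, mulrDl, linearD) /= => -> ->.
by rewrite !tprodM !slicerE e -scalerAr -scalerAl.
Qed.

Lemma slicel_sandwich phi phi' a b c d t :
  (forall x, phi (a * x * c) = phi' x) ->
  slicel phi ((a ⊗ b) * t * (c ⊗ d)) = b * slicel phi' t * d.
Proof.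
move=> e; elim/tens_ind: t => [x y|x y].
  by rewrite !(mulrDr, mulrDl, linearD) /= => -> ->.
by rewrite !tprodM !slicelE e -scalerAr -scalerAl.
Qed.

Lemma slicerMl phi s t :
  slicer phi (s * t) = \tsum_(b ⊗ c <- s) b * slicer phi ((1 ⊗ c) * t).
Proof.
elim/tens_ind: s => [x y|a b]; first by rewrite mulrDl !linearD /= => -> ->.
rewrite tliftE; last first.
  split=> [w|v] e x y /=; first by rewrite mulrDl -scalerAl.
  by rewrite linearP mulrDl -scalerAl linearP mulrDr -scalerAr.
elim/tens_ind: t => [x y|c d]; first by rewrite !(mulrDr, linearD) /= => -> ->.
by rewrite !tprodM !slicerE mul1r -scalerAr.
Qed.

Lemma slicelMr phi s t :
  slicel phi (s * t) = \tsum_(b ⊗ c <- t) slicel phi (s * (b ⊗ 1)) * c.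
Proof.
elim/tens_ind: t => [x y|a b]; first by rewrite mulrDr !linearD /= => -> ->.
rewrite tliftE; last first.
  split=> [w|v] e x y /=; last by rewrite mulrDr -scalerAr.
  by rewrite tprodPl mulrDr -scalerAr linearP mulrDl -scalerAl.
elim/tens_ind: s => [x y|c d]; first by rewrite !(mulrDl, linearD) /= => -> ->.
by rewrite !tprodM !slicelE mulr1 -scalerAl.
Qed.

Lemma fubini_slice phi psi t : psi (slicer phi t) = phi (slicel psi t).
Proof.
elim/tens_ind: t => [x y|a b]; first by rewrite !linearD /= => -> ->.
by rewrite slicerE slicelE !linearZ; apply: mulrC.
Qed.

Lemma lact_linear phi : linear (fun g => g ⇀ phi).
Proof.
by move=> c x y; apply/lfunP=> z; rewrite add_lfunE scale_lfunE !lactE mulrDr -scalerAr linearP.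
Qed.

Lemma ract_linear phi : linear (fun g => phi ↼ g).
Proof.
by move=> c x y; apply/lfunP=> z; rewrite add_lfunE scale_lfunE !ractE mulrDl -scalerAl linearP.
Qed.

End Slices.

(** * A criterion for integrals *)

Section Integrals.
Variables (k : fieldType) (H : falgType k) (X : hopfAlgebra H).
Implicit Types (phi chi psi lambda rho : 'Hom(H, k^o)) (g h t : H).
Notation Δ := (comul X).
Notation ε := (counit X).
Notation S := (antipode X).

(** By coassociativity, slicing Delta(t) by the convolution psi * phi amounts
    to applying (id (x) psi) Delta to t_1 phi(t_2) = c 1, hence gives
    psi(1) c 1, which is also the slice by psi(1) phi.  Injectivity turns this
    into psi * phi = psi(1) phi for every psi, that is, h_1 phi(h_2) = phi(h) 1. *)
Lemma left_integral_test phi t (c : k) :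
  injective (fun chi => slicer chi (Δ t)) ->
  slicer phi (Δ t) = c *: 1 -> left_integral_on X phi.
Proof.
move=> inj e h; apply: functional_ext => psi; rewrite -/(slicer phi (Δ h)).
pose conv := linfun (psi \o (slicer phi \o Δ)).
suff /inj/lfunP/(_ h): slicer conv (Δ t) = slicer (psi 1 *: phi) (Δ t).
  by rewrite lfunE scale_lfunE /= => ->; rewrite linearZ; apply: mulrC.
have -> : slicer (psi 1 *: phi) (Δ t) = psi 1 *: slicer phi (Δ t).
  by rewrite scaler_tlift; apply: eq_tlift => x y; rewrite scale_lfunE -scalerA.
suff -> : slicer conv (Δ t) = slicer psi (Δ (slicer phi (Δ t))).
  by rewrite e !linearZ /= rmorph1 -tprod11 slicerE !scalerA mulrC.
transitivity (\tsum_(a ⊗ y <- Δ t) \tsum_(b ⊗ d <- Δ y) ((phi d * psi b : k) *: a)).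
  apply: eq_tlift => a y; rewrite lfunE /=.
  rewrite (linear_tlift psi) /tlift scaler_suml; apply: eq_bigr => i _.
  rewrite scaler_suml; apply: eq_bigr => j _; rewrite linearZ /=.
  exact: esym (scalerA _ _ _).
rewrite comul_sweedler; last first.
  split=> u v e' x y /=; first by rewrite linearP.
    by rewrite linearP /= mulrDr scalerDl !scalerA mulrCA.
  by rewrite linearP /= mulrDl scalerDl !scalerA mulrA.
rewrite (linear_tlift Δ) (linear_tlift (slicer psi)); apply: eq_tlift => a b.
by rewrite !linearZ /= scaler_tlift; apply: eq_tlift => ? ? /=; rewrite scalerA.
Qed.

(** The mirror image of [left_integral_test]. *)
Lemma right_integral_test phi t (c : k) :
  injective (fun chi => slicel chi (Δ t)) ->
  slicel phi (Δ t) = c *: 1 -> right_integral_on X phi.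
Proof.
move=> inj e h; apply: functional_ext => psi; rewrite -/(slicel phi (Δ h)).
pose conv := linfun (psi \o (slicel phi \o Δ)).
suff /inj/lfunP/(_ h): slicel conv (Δ t) = slicel (psi 1 *: phi) (Δ t).
  by rewrite lfunE scale_lfunE /= => ->; rewrite linearZ; apply: mulrC.
have -> : slicel (psi 1 *: phi) (Δ t) = psi 1 *: slicel phi (Δ t).
  by rewrite scaler_tlift; apply: eq_tlift => x y; rewrite scale_lfunE -scalerA.
suff -> : slicel conv (Δ t) = slicel psi (Δ (slicel phi (Δ t))).
  by rewrite e !linearZ /= rmorph1 -tprod11 slicelE !scalerA mulrC.
transitivity (\tsum_(y ⊗ d <- Δ t) \tsum_(a ⊗ b <- Δ y) ((phi a * psi b : k) *: d)).
  apply: eq_tlift => y d; rewrite lfunE /=.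
  rewrite (linear_tlift psi) /tlift scaler_suml; apply: eq_bigr => i _.
  rewrite scaler_suml; apply: eq_bigr => j _; rewrite linearZ /=.
  exact: esym (scalerA _ _ _).
rewrite -comul_sweedler; last first.
  split=> u v e' x y /=; last by rewrite linearP.
    by rewrite linearP /= mulrDl scalerDl !scalerA mulrA.
  by rewrite linearP /= mulrDr scalerDl !scalerA mulrCA.
rewrite (linear_tlift Δ) (linear_tlift (slicel psi)); apply: eq_tlift => a b.
by rewrite !linearZ /= scaler_tlift; apply: eq_tlift => ? ? /=; rewrite scalerA.
Qed.

(** * Integrals and the antipode *)

(** This is the identity S(h_1) h_2 (x) h_3 = 1 (x) h, multiplied by T and then
    sliced.  With T a coproduct, the slice on the left is that of the
    coproduct of a product, which an integral collapses to a scalar. *)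
Lemma antipode_slicer phi h (T : tens H H) :
  \tsum_(a ⊗ y <- Δ h) S a * slicer phi (Δ y * T) = slicer phi ((1 ⊗ h) * T).
Proof.
transitivity (\tsum_(a ⊗ y <- Δ h) \tsum_(b ⊗ c <- Δ y)
    (S a * b * slicer phi ((1 ⊗ c) * T))).
  apply: eq_tlift => a y; rewrite slicerMl mulr_tlift.
  by apply: eq_tlift => b c; rewrite mulrA.
rewrite comul_sweedler; last first.
  split=> u v e x y /=.
  - by rewrite linearP !mulrDl -!scalerAl.
  - by rewrite mulrDr mulrDl -scalerAr -scalerAl.
  by rewrite linearP /= mulrDl -scalerAl linearP /= mulrDr -scalerAr.
pose L c := slicer phi ((1 ⊗ c) * T).
have linL : linear L by move=> e x y; rewrite /L linearP /= mulrDl -scalerAl linearP.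
pose L' := HB.pack_for {linear H -> H} L (GRing.isLinear.Build k H H _ L linL).
rewrite -[RHS]/(L' h) -{2}[h](counitl X) linear_tlift; apply: eq_tlift => x c.
by rewrite linearZ /= -mull_tlift antipodel -scalerAl mul1r.
Qed.

(** The mirror identity is h_1 (x) h_2 S(h_3) = h (x) 1. *)
Lemma antipode_slicel phi h (T : tens H H) :
  \tsum_(y ⊗ c <- Δ h) slicel phi (T * Δ y) * S c = slicel phi (T * (h ⊗ 1)).
Proof.
transitivity (\tsum_(y ⊗ c <- Δ h) \tsum_(a ⊗ b <- Δ y)
    (slicel phi (T * (a ⊗ 1)) * (b * S c))).
  apply: eq_tlift => y c; rewrite slicelMr mull_tlift.
  by apply: eq_tlift => a b; rewrite mulrA.
rewrite -comul_sweedler; last first.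
  split=> u v e x y /=.
  - by rewrite tprodPl mulrDr -scalerAr linearP /= mulrDl -scalerAl.
  - by rewrite mulrDl mulrDr -scalerAl -scalerAr.
  by rewrite linearP !mulrDr -!scalerAr.
pose L c := slicel phi (T * (c ⊗ 1)).
have linL : linear L by move=> e x y; rewrite /L tprodPl mulrDr -scalerAr linearP.
pose L' := HB.pack_for {linear H -> H} L (GRing.isLinear.Build k H H _ L linL).
rewrite -[RHS]/(L' h) -{2}[h](counitr X) linear_tlift; apply: eq_tlift => x c.
by rewrite linearZ /= -mulr_tlift antipoder -scalerAr mulr1.
Qed.

(** S(h_1) lambda(h_2 g) = S(h_1) h_2 g_1 lambda(h_3 g_2) = g_1 lambda(h g_2). *)
Lemma left_integral_antipode lambda g h : left_integral_on X lambda ->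
  S (slicer (g ⇀ lambda) (Δ h)) = slicer (lambda ↼ h) (Δ g).
Proof.
move=> lamP.
have -> : slicer (lambda ↼ h) (Δ g) = slicer lambda ((1 ⊗ h) * Δ g).
  have := @slicer_sandwich k H lambda (lambda ↼ h) 1 h 1 1 (Δ g).
  rewrite tprod11 !mulr1 mul1r => -> // x.
  by rewrite mulr1 ractE.
rewrite -antipode_slicer linear_tlift; apply: eq_tlift => a y.
by rewrite -rmorphM [slicer _ _]lamP linearZ /= lactE -scalerAr mulr1.
Qed.

(** rho(h g_1) S(g_2) = rho(h_1 g_1) h_2 g_2 S(g_3) = rho(h_1 g) h_2. *)
Lemma right_integral_antipode rho g h : right_integral_on X rho ->
  S (slicel (rho ↼ h) (Δ g)) = slicel (g ⇀ rho) (Δ h).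
Proof.
move=> rhoP.
have -> : slicel (g ⇀ rho) (Δ h) = slicel rho (Δ h * (g ⊗ 1)).
  have := @slicel_sandwich k H rho (g ⇀ rho) 1 1 g 1 (Δ h).
  rewrite tprod11 !mulr1 !mul1r => -> // x.
  by rewrite mul1r lactE.
rewrite -antipode_slicel linear_tlift; apply: eq_tlift => y c.
by rewrite -rmorphM [slicel _ _]rhoP linearZ /= ractE -scalerAl mul1r.
Qed.

(** The radical N of the form (h, g) |-> lambda(h g) is a left ideal, and by
    [left_integral_antipode] it is stable under g |-> f(g_1) g_2.  Hence it
    contains S(g_1) g_2 = eps(g) 1, so eps vanishes on N, lambda being non-zero;
    then f(g) = eps(f(g_1) g_2) = 0 for every functional f, so N = 0. *)
Lemma lact_inj lambda : left_integral_on X lambda -> lambda != 0 ->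
  injective (fun g => g ⇀ lambda).
Proof.
move=> lamP lam0.
have kerN g f : g ⇀ lambda = 0 -> slicel f (Δ g) ⇀ lambda = 0.
  move=> g0; apply/lfunP=> h; rewrite zero_lfunE lactE -ractE -fubini_slice.
  rewrite -left_integral_antipode // g0.
  have -> : slicer 0 (Δ h) = 0.
    by apply: functional_ext => psi; rewrite fubini_slice zero_lfunE linear0.
  by rewrite !linear0.
have epsN g : g ⇀ lambda = 0 -> ε g = 0.
  move=> g0; apply/eqP; apply: contraNT lam0 => eg; apply/eqP/lfunP=> x.
  (* ε g * lambda x = lambda (x * S g_1 * g_2), and each g_2 is in the radical. *)
  apply: (scalerI eg); rewrite zero_lfunE scaler0 -linearZ /=.
  rewrite -[ε g *: x]mulr1 -scalerAl scalerAr -antipodel -antl1E.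
  rewrite [Δ g in LHS]tens_slicel_basis /antl linear_sum /= -/(antl _ _ _).
  rewrite mulr_sumr linear_sum /=; apply: big1 => i _.
  rewrite -/(antl _ _ _) antlE mulr1 mulrA -lactE.
  by rewrite [_ ⇀ _](kerN g _ g0) zero_lfunE.
have ker0 g : g ⇀ lambda = 0 -> g = 0.
  move=> g0; apply: functional_ext => f; rewrite linear0.
  have := epsN _ (kerN g f g0); rewrite /slicel linear_tlift.
  rewrite -{2}[g](counitr X) linear_tlift => <-.
  by apply: eq_tlift => a b; rewrite !linearZ; apply: mulrC.
move=> g g' e; apply/eqP; rewrite -subr_eq0; apply/eqP/ker0/lfunP => x.
by rewrite lactE zero_lfunE mulrBr linearB /= -!lactE e subrr.
Qed.

(** The element t representing eps satisfies lambda(h g t) = eps(h) eps(g) =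
    lambda(h (eps(g) t)), whence g t = eps(g) t by nondegeneracy. *)
Lemma integral_dual_to lambda : left_integral_on X lambda -> lambda != 0 ->
  exists t, left_integral_in X t /\ t ⇀ lambda = linfun ε.
Proof.
move=> lamP lam0; have inj := lact_inj lamP lam0.
have [t te] := functional_repr (lact_linear lambda) inj (linfun ε).
exists t; split=> // h; apply: inj; apply/lfunP=> x.
have tE y : lambda (y * t) = ε y by rewrite -lactE -te lfunE.
by rewrite !lactE mulrA tE -scalerAr linearZ /= tE rmorphM mulrC.
Qed.

(** * The Frobenius structure given by a two-sided integral *)

Section Frobenius.
Variables (lambda : 'Hom(H, k^o)) (t : H).
Hypotheses (lamP : left_integral_on X lambda) (lam0 : lambda != 0).
Hypotheses (tl : left_integral_in X t) (tr : right_integral_in X t).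
Hypothesis (tE : t ⇀ lambda = linfun ε).

Lemma slicer_ract_integral g : slicer (lambda ↼ g) (Δ t) = S g.
Proof.
rewrite -left_integral_antipode // tE -{2}[g](counitr X); congr (S _).
by apply: eq_tlift => a b; rewrite lfunE.
Qed.

(** [left_integral_antipode] with h = t turns the left side into
    g_1 lambda(t g_2), and t is a right integral with lambda(t) = 1. *)
Lemma antipode_slicer_lact_integral g : S (slicer (g ⇀ lambda) (Δ t)) = g.
Proof.
have t1 : lambda t = 1 by rewrite -[t]mul1r -lactE tE lfunE /= rmorph1.
rewrite left_integral_antipode // -[RHS](counitr X); apply: eq_tlift => a b.
by rewrite ractE tr linearZ /= t1; congr (_ *: _); apply: mulr1.
Qed.

Lemma antipode_surj g : exists h, g = S h.
Proof. by exists (slicer (g ⇀ lambda) (Δ t)); rewrite antipode_slicer_lact_integral. Qed.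

Lemma antipode_inj : injective S.
Proof.
pose f : 'End(H) := linfun S.
have fS x : f x = S x by rewrite lfunE.
suff /lker0P fI : lker f == 0%VS by move=> x y; rewrite -!fS => /fI.
have f_full : limg f = fullv.
  apply/vspaceP=> g; rewrite memvf; have [h ->] := antipode_surj g.
  by rewrite -fS memv_img ?memvf.
by rewrite -dimv_eq0 -(eqn_add2r (\dim (limg f))) -{1}(capfv (lker f)) limg_ker_dim f_full.
Qed.

(** The rule lambda(x y) = lambda(y S^2(x)): S^2 is the Nakayama automorphism of
    lambda.  Write lambda(x _) as lambda(_ y) for some y; slicing Delta(t) by
    this functional and applying S gives S^2(x) in the first form and y in the
    second. *)
Lemma left_integral_nakayama x : S (S x) ⇀ lambda = lambda ↼ x.
Proof.
have [y /= ye] := functional_repr (lact_linear lambda) (lact_inj lamP lam0) (lambda ↼ x).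
by rewrite ye -(slicer_ract_integral x) ye antipode_slicer_lact_integral.
Qed.

Section Right.
Variables (rho : 'Hom(H, k^o)).
Hypotheses (rhoP : right_integral_on X rho) (rho0 : rho != 0).

Lemma antipode_slicel_ract_integral g : S (slicel (rho ↼ g) (Δ t)) = rho t *: g.
Proof.
rewrite right_integral_antipode // -[in RHS](counitl X g) scaler_tlift.
apply: eq_tlift => a b; rewrite lactE tl linearZ scalerA; congr (_ *: _).
exact: mulrC.
Qed.

Lemma slicel_lact_integral g : slicel (g ⇀ rho) (Δ t) = rho t *: S g.
Proof.
transitivity (S (rho t *: g)); last by rewrite linearZ.
rewrite -right_integral_antipode //; congr (S _).
rewrite -[in RHS](counitl X g) scaler_tlift; apply: eq_tlift => a b.
by rewrite ractE tr linearZ /= scalerA; congr (_ *: _); apply: mulrC.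
Qed.

(** Computing (rho (x) lambda(x _)) Delta(t) by slicing on either side first. *)
Lemma right_integral_comp_antipode x : rho (S x) = rho t * lambda x.
Proof.
rewrite -slicer_ract_integral fubini_slice ractE.
by rewrite [slicel _ _]rhoP -scalerAr mulr1 linearZ.
Qed.

Lemma right_integral_neq0 : rho t != 0.
Proof.
apply: contraNneq rho0 => r0; apply/eqP/lfunP=> x; have [y ->] := antipode_surj x.
by rewrite right_integral_comp_antipode r0 mul0r zero_lfunE.
Qed.

Lemma ract_inj : injective (fun g => rho ↼ g).
Proof.
move=> g g' e; apply: (scalerI right_integral_neq0).
by rewrite -!antipode_slicel_ract_integral e.
Qed.

(** For a right integral the rule is rho(y x) = rho(S^2(x) y), by the same
    argument as in [left_integral_nakayama]. *)
Lemma right_integral_nakayama x : rho ↼ S (S x) = x ⇀ rho.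
Proof.
have [y /= ye] := functional_repr (ract_linear rho) ract_inj (x ⇀ rho).
rewrite ye; congr (_ ↼ _); apply: (scalerI right_integral_neq0).
by rewrite -[RHS]antipode_slicel_ract_integral -ye slicel_lact_integral linearZ.
Qed.

End Right.

(** For pure tensors u = a (x) b and v = c (x) d the left side is
    S(c) S(t_1) S(a) lambda(b t_2 d g); moving b cyclically by
    [left_integral_nakayama] and slicing leaves
    S(c) d g S^2(b) S(a) = (S(c) d) g S(a S(b)). *)
Lemma slicer_lact_twist (u v : tens H H) g :
  S (slicer (g ⇀ lambda) (u * Δ t * v)) = antl X 1 v * g * S (antr X 1 u).
Proof.
elim/tens_ind: u => [x y|a b].
  by rewrite antrD !(mulrDl, mulrDr, linearD) /= => -> ->.
elim/tens_ind: v => [x y|c d].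
  by rewrite antlD !(mulrDr, linearD) /= !mulrDl => -> ->.
rewrite (slicer_sandwich (phi' := (d * g * S (S b)) ⇀ lambda)); last first.
  move=> x; rewrite lactE -!mulrA -ractE -left_integral_nakayama // !lactE.
  by rewrite !mulrA.
rewrite !antipodeM antipode_slicer_lact_integral // antlE antrE !mulr1 antipodeM.
by rewrite !mulrA.
Qed.

(** For pure tensors, c is the factor that moves cyclically, leaving
    S(d) S^2(c) g a S(b) = S(S(c) d) g (a S(b)). *)
Lemma slicel_ract_twist rho (u v : tens H H) g :
  right_integral_on X rho -> rho != 0 ->
  S (slicel (rho ↼ g) (u * Δ t * v)) =
  rho t *: (S (antl X 1 v) * g * antr X 1 u).
Proof.
move=> rhoP rho0.
elim/tens_ind: u => [x y|a b].
  by rewrite antrD !(mulrDl, mulrDr) !linearD /= => -> ->.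
elim/tens_ind: v => [x y|c d].
  by rewrite antlD !(mulrDr, linearD) /= !mulrDl => -> ->; rewrite scalerDr.
rewrite (slicel_sandwich (phi' := rho ↼ (S (S c) * g * a))); last first.
  move=> x; rewrite !ractE !mulrA -lactE -right_integral_nakayama // ractE.
  by rewrite !mulrA.
rewrite !antipodeM antipode_slicel_ract_integral // antlE antrE !mulr1 antipodeM.
by rewrite -scalerAl -scalerAr !mulrA.
Qed.

End Frobenius.

End Integrals.

(** * Integrals on the twisted Hopf algebra *)

Section Twist.
Variables (k : fieldType) (H : falgType k) (X : hopfAlgebra H).
Variables (J : tens H H) (twJ : is_twist X J).
Notation S := (antipode X).
Notation Q := (twistQ X J).

Lemma antipode_unit x : x \is a GRing.unit -> S x \is a GRing.unit.
Proof.
move=> xU; apply/unitrP; exists (S x^-1).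
by rewrite -!antipodeM mulrV // mulVr // antipode1.
Qed.

Lemma antipodeV x : x \is a GRing.unit -> S x^-1 = (S x)^-1.
Proof.
move=> xU; apply: (mulIr (antipode_unit xU)).
by rewrite -antipodeM mulrV // antipode1 mulVr // antipode_unit.
Qed.

Lemma twistu_unit : twistu X J \is a GRing.unit.
Proof.
have QU := twistQ_unit twJ.
by rewrite unitrMr ?unitrV // antipode_unit.
Qed.

Section TwistedIntegrals.
Variables (lambda rho : 'Hom(H, k^o)) (t : H).
Hypotheses (lamP : left_integral_on X lambda) (lam0 : lambda != 0).
Hypotheses (rhoP : right_integral_on X rho) (rho0 : rho != 0).
Hypotheses (tl : left_integral_in X t) (tr : right_integral_in X t).
Hypothesis (tE : t ⇀ lambda = linfun (counit X)).

Lemma slicer_twisted_comul g :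
  S (slicer (g ⇀ lambda) (twisted_comul X J t)) = Q * g * (S Q)^-1.
Proof.
rewrite (slicer_lact_twist lamP lam0 tr tE) antlQ antr1E -twistQ_inv //.
by rewrite antipodeV ?twistQ_unit.
Qed.

Lemma slicel_twisted_comul g :
  S (slicel (rho ↼ g) (twisted_comul X J t)) = rho t *: (S Q * g * Q^-1).
Proof.
by rewrite (slicel_ract_twist lamP tl tr tE) // antlQ antr1E -twistQ_inv.
Qed.

Lemma lact_twistu_left_integral : left_integral_on (twisted twJ) (twistu X J ⇀ lambda).
Proof.
have QU := twistQ_unit twJ; have SQU := antipode_unit QU.
apply: (left_integral_test (t := t) (c := 1)) => [chi chi'|].
  have [g /= ->] := functional_repr (lact_linear lambda) (lact_inj lamP lam0) chi.
  have [g' /= ->] := functional_repr (lact_linear lambda) (lact_inj lamP lam0) chi'.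
  move=> /(congr1 S); rewrite !slicer_twisted_comul.
  have SQVU : (S Q)^-1 \is a GRing.unit by rewrite unitrV.
  by move/(mulIr SQVU)/(mulrI QU) => ->.
rewrite scale1r; apply: (antipode_inj lamP tr tE).
by rewrite slicer_twisted_comul /twistu antipode1 mulVKr ?divrr.
Qed.

Lemma ract_twistu_right_integral :
  right_integral_on (twisted twJ) (rho ↼ (twistu X J)^-1).
Proof.
have QU := twistQ_unit twJ; have SQU := antipode_unit QU.
have rinj := ract_inj lamP tl tr tE rhoP rho0.
apply: (right_integral_test (t := t) (c := rho t)) => [chi chi'|].
  have [g /= ->] := functional_repr (ract_linear rho) rinj chi.
  have [g' /= ->] := functional_repr (ract_linear rho) rinj chi'.
  move=> /(congr1 S); rewrite !slicel_twisted_comul.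
  move/(scalerI (right_integral_neq0 lamP tr tE rhoP rho0)).
  have QVU : Q^-1 \is a GRing.unit by rewrite unitrV.
  by move/(mulIr QVU)/(mulrI SQU) => ->.
apply: (antipode_inj lamP tr tE).
rewrite slicel_twisted_comul linearZ /= antipode1 /twistu.
by rewrite invrM ?unitrV // invrK mulVKr ?divrr.
Qed.

End TwistedIntegrals.
End Twist.

Theorem theorem3p4 (k : closedFieldType) (H : falgType k) (X : hopfAlgebra H)
    (J : tens H H) (twJ : is_twist X J) (lambda rho : 'Hom(H, k^o)) :
  unimodular X ->
  lambda != 0 -> left_integral_on X lambda ->
  rho != 0 -> right_integral_on X rho ->
  let lambdaJ := twistu X J ⇀ lambda in
  let rhoJ := rho ↼ (twistu X J)^-1 in
  (lambdaJ != 0 /\ left_integral_on (twisted twJ) lambdaJ) /\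
  (rhoJ != 0 /\ right_integral_on (twisted twJ) rhoJ).
Proof.
move=> uniX lam0 lamP rho0 rhoP lambdaJ rhoJ.
have [t [tl tE]] := integral_dual_to lamP lam0.
have tr : right_integral_in X t by apply/uniX.
have uU := twistu_unit twJ.
split; split.
- apply: contra_neq lam0 => l0; apply/lfunP=> x.
  by rewrite zero_lfunE -(divrK uU x) -lactE -/lambdaJ l0 zero_lfunE.
- exact: lact_twistu_left_integral tr tE.
- apply: contra_neq rho0 => r0; apply/lfunP=> x.
  by rewrite zero_lfunE -(mulKr uU x) -ractE -/rhoJ r0 zero_lfunE.
exact: ract_twistu_right_integral lamP rhoP rho0 tl tr tE.
Qed.
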